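(* Let $\mathbb{K}$ be a field of characteristic zero, $\Gamma$ an abelian group, $\epsilon$ a commuting factor on $\Gamma$, and let $\mathfrak{g}=\bigoplus_{\gamma\in\Gamma}\mathfrak{g}_\gamma$ be a color Lie algebra over $\mathbb{K}$ with respect to $(\Gamma,\epsilon)$, with graded Lie bracket $\llbracket\ ,\ \rrbracket$. Define linear maps $S:\mathfrak{g}\otimes\mathfrak{g}\to\mathfrak{g}\otimes\mathfrak{g}$ and $f:\mathfrak{g}\otimes\mathfrak{g}\to\mathfrak{g}$ by $$S(X\otimes Y)=\epsilon(\alpha,\beta)\,Y\otimes X,\qquad f(X\otimes Y)=\llbracket X,Y\rrbracket,\qquad X\in\mathfrak{g}_\alpha,\ Y\in\mathfrak{g}_\beta,\ \alpha,\beta\in\Gamma,$$ extended linearly. Then $(\mathfrak{g},f,S)$ is an $S$-Lie algebra.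
   Context: A commuting factor on an abelian group $\Gamma$ (written additively) is a map $\epsilon:\Gamma\times\Gamma\to\mathbb{K}\setminus\{0\}$ with $\epsilon(\alpha,\beta)\epsilon(\beta,\alpha)=1$, $\epsilon(\alpha,\beta+\gamma)=\epsilon(\alpha,\beta)\epsilon(\alpha,\gamma)$ and $\epsilon(\alpha+\beta,\gamma)=\epsilon(\alpha,\gamma)\epsilon(\beta,\gamma)$ for all $\alpha,\beta,\gamma\in\Gamma$. A color Lie algebra (for $\Gamma$ and $\epsilon$) is a $\Gamma$-graded $\mathbb{K}$-vector space $\mathfrak{g}=\bigoplus_{\gamma\in\Gamma}\mathfrak{g}_\gamma$ with a bilinear map $\llbracket\ ,\ \rrbracket:\mathfrak{g}\times\mathfrak{g}\to\mathfrak{g}$ such that for all $X\in\mathfrak{g}_\alpha$, $Y\in\mathfrak{g}_\beta$, $Z\in\mathfrak{g}_\gamma$: (1) $\llbracket X,Y\rrbracket\in\mathfrak{g}_{\alpha+\beta}$; (2) $\llbracket X,Y\rrbracket=-\epsilon(\alpha,\beta)\llbracket Y,X\rrbracket$; (3) $\epsilon(\gamma,\alpha)\llbracket X,\llbracket Y,Z\rrbracket\rrbracket+\epsilon(\alpha,\beta)\llbracket Y,\llbracket Z,X\rrbracket\rrbracket+\epsilon(\beta,\gamma)\llbracket Z,\llbracket X,Y\rrbracket\rrbracket=0$. An $S$-Lie algebra is a $\mathbb{K}$-vector space $L$ with linear maps $f:L\otimes L\to L$ and $S:L\otimes L\to L\otimes L$ satisfying 1. $S^2=\mathrm{id}_{L\otimes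 L}$; 2. $S_{12}S_{23}S_{12}=S_{23}S_{12}S_{23}$; 3. $S f_{12}=f_{23}S_{12}S_{23}$; 4. $S f_{23}=f_{12}S_{23}S_{12}$; 5. $fS=-f$; 6. $f f_{12}=f f_{23}-f f_{23}S_{12}$. Here $S_{12}=S\otimes\mathrm{id}$, $S_{23}=\mathrm{id}\otimes S$, $f_{12}=f\otimes\mathrm{id}$, $f_{23}=\mathrm{id}\otimes f$ on $L\otimes L\otimes L$, and products of maps are compositions (the rightmost map is applied first). *)

(* Defs.v *)
From HB Require Import structures.
From mathcomp Require Import all_boot all_algebra.
From mathcomp Require Import boolp.

Set Implicit Arguments.
Unset Strict Implicit.
Unset Printing Implicit Defensive.

Import GRing.Theory.
Local Open Scope ring_scope.
Local Open Scope quotient_scope.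

Section TensorProduct.
Variables (R : comNzRingType) (U V : lmodType R).

(* A sequence [:: (u1, v1); ...; (un, vn)] stands for the formal sum
   u1 (x) v1 + ... + un (x) vn.  The tensor product is the quotient of these
   formal sums by the congruence generated by commutativity of the sum and the
   bilinearity relations; its universal property is given by the lemmas
   tensor_liftE and tensor_lift_unique. *)
Inductive tensor_rel : seq (U * V) -> seq (U * V) -> Prop :=
| tensor_rel_refl s : tensor_rel s s
| tensor_rel_sym s t : tensor_rel s t -> tensor_rel t s
| tensor_rel_trans s t r : tensor_rel s t -> tensor_rel t r -> tensor_rel s r
| tensor_rel_cat s s' t t' :
    tensor_rel s s' -> tensor_rel t t' -> tensor_rel (s ++ t) (s' ++ t')
| tensor_rel_comm s t : tensor_rel (s ++ t) (t ++ s)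
| tensor_rel_0l v : tensor_rel [:: (0, v)] [::]
| tensor_rel_0r u : tensor_rel [:: (u, 0)] [::]
| tensor_rel_Dl u u' v :
    tensor_rel [:: (u + u', v)] [:: (u, v); (u', v)]
| tensor_rel_Dr u v v' :
    tensor_rel [:: (u, v + v')] [:: (u, v); (u, v')]
| tensor_rel_Z a u v : tensor_rel [:: (a *: u, v)] [:: (u, a *: v)].

Definition tensor_relb : rel (seq (U * V)) := fun s t => `[< tensor_rel s t >].

Lemma tensor_relb_equiv : equiv_class_of tensor_relb.
Proof.
split=> [s|s t|t s r].
- by apply/asboolP; exact: tensor_rel_refl.
- by apply/asboolP/asboolP; exact: tensor_rel_sym.
- move=> /asboolP st /asboolP tr; apply/asboolP.
  exact: tensor_rel_trans st tr.
Qed.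

Canonical tensor_equiv := EquivRelPack tensor_relb_equiv.

Definition tensor := {eq_quot tensor_relb}.

HB.instance Definition _ := Choice.on tensor.
HB.instance Definition _ := EqQuotient.on tensor.

Local Notation "<< s >>" := (\pi_tensor s).

Lemma tensor_eqP s t : << s >> = << t >> <-> tensor_rel s t.
Proof.
split=> [/eqquotP/asboolP //|st].
by apply/eqquotP/asboolP.
Qed.

Definition tensor_zero : tensor := << [::] >>.
Definition tensor_add (x y : tensor) : tensor := << repr x ++ repr y >>.
Definition tensor_opp (x : tensor) : tensor :=
  << [seq (- p.1, p.2) | p <- repr x] >>.
Definition tensor_scale (a : R) (x : tensor) : tensor :=
  << [seq (a *: p.1, p.2) | p <- repr x] >>.

Lemma tensor_repr s : tensor_rel (repr << s >>) s.
Proof. by apply/tensor_eqP; rewrite reprK. Qed.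

Lemma tensor_rel_map a s t : tensor_rel s t ->
  tensor_rel [seq (a *: p.1, p.2) | p <- s] [seq (a *: p.1, p.2) | p <- t].
Proof.
elim=> {s t} /=.
- by move=> s; exact: tensor_rel_refl.
- by move=> s t _; exact: tensor_rel_sym.
- by move=> s t r _ st _; exact: tensor_rel_trans.
- by move=> s s' t t' _ ss' _ tt'; rewrite !map_cat; exact: tensor_rel_cat.
- by move=> s t; rewrite !map_cat; exact: tensor_rel_comm.
- by move=> v; rewrite scaler0; exact: tensor_rel_0l.
- by move=> u; exact: tensor_rel_0r.
- by move=> u u' v; rewrite scalerDr; exact: tensor_rel_Dl.
- by move=> u v v'; exact: tensor_rel_Dr.
- by move=> b u v; rewrite scalerA mulrC -scalerA; exact: tensor_rel_Z.
Qed.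

Lemma tensor_addE s t : tensor_add << s >> << t >> = << s ++ t >>.
Proof. by apply/tensor_eqP; apply: tensor_rel_cat; exact: tensor_repr. Qed.

Lemma tensor_scaleE a s :
  tensor_scale a << s >> = << [seq (a *: p.1, p.2) | p <- s] >>.
Proof. by apply/tensor_eqP; apply: tensor_rel_map; exact: tensor_repr. Qed.

Lemma tensor_oppE x : tensor_opp x = tensor_scale (-1) x.
Proof. by congr (\pi_tensor _); apply: eq_map => p; rewrite scaleN1r. Qed.

Lemma tensor_addA : associative tensor_add.
Proof.
elim/quotW=> s; elim/quotW=> t; elim/quotW=> r.
by rewrite (tensor_addE t r) (tensor_addE s t) !tensor_addE catA.
Qed.

Lemma tensor_addC : commutative tensor_add.
Proof. by move=> x y; apply/tensor_eqP; exact: tensor_rel_comm. Qed.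

Lemma tensor_add0 : left_id tensor_zero tensor_add.
Proof. by elim/quotW=> s; rewrite tensor_addE. Qed.

Lemma tensor_scaleDl x : {morph tensor_scale^~ x : a b / a + b >-> tensor_add a b}.
Proof.
move=> a b; elim/quotW: x => s; rewrite !tensor_scaleE tensor_addE.
apply/tensor_eqP; elim: s => [|[u v] s IH] /=; first exact: tensor_rel_refl.
rewrite scalerDl -cat1s.
apply: tensor_rel_trans (tensor_rel_cat (tensor_rel_Dl _ _ _) IH) _ => /=.
rewrite -[X in tensor_rel X]cat1s -[X in tensor_rel _ X]cat1s.
apply: tensor_rel_cat; first exact: tensor_rel_refl.
rewrite -cat1s catA -[X in tensor_rel _ (_ ++ X)]cat1s catA.
apply: tensor_rel_cat; last exact: tensor_rel_refl.
exact: tensor_rel_comm.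
Qed.

Lemma tensor_scale0 x : tensor_scale 0 x = tensor_zero.
Proof.
elim/quotW: x => s; rewrite tensor_scaleE; apply/tensor_eqP.
elim: s => [|[u v] s IH] /=; first exact: tensor_rel_refl.
rewrite scale0r -cat1s -[[::]]cats0.
exact: tensor_rel_cat (tensor_rel_0l _) IH.
Qed.

Lemma tensor_scale1 : left_id 1 tensor_scale.
Proof.
elim/quotW=> s; rewrite tensor_scaleE; congr (\pi_tensor _).
by rewrite -[RHS]map_id; apply: eq_map => -[u v]; rewrite scale1r.
Qed.

Lemma tensor_addN : left_inverse tensor_zero tensor_opp tensor_add.
Proof.
move=> x; rewrite tensor_oppE -[X in tensor_add _ X]tensor_scale1.
by rewrite -tensor_scaleDl addNr tensor_scale0.
Qed.

HB.instance Definition _ := GRing.isZmodule.Build tensor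
  tensor_addA tensor_addC tensor_add0 tensor_addN.

Lemma tensor_scaleA a b x :
  tensor_scale a (tensor_scale b x) = tensor_scale (a * b) x.
Proof.
elim/quotW: x => s; rewrite (tensor_scaleE b s) !tensor_scaleE -map_comp; congr (\pi_tensor _).
by apply: eq_map => -[u v] /=; rewrite scalerA.
Qed.

Lemma tensor_scaleDr : right_distributive tensor_scale +%R.
Proof.
move=> a; elim/quotW=> s; elim/quotW=> t.
rewrite [X in tensor_scale _ X](tensor_addE s t) (tensor_scaleE a s).
by rewrite (tensor_scaleE a t) tensor_scaleE map_cat [RHS]tensor_addE.
Qed.

HB.instance Definition _ := GRing.Zmodule_isLmodule.Build R tensor
  tensor_scaleA tensor_scale1 tensor_scaleDr tensor_scaleDl.

Definition tens (u : U) (v : V) : tensor := << [:: (u, v)] >>.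

Lemma tens_bilinear :
  (forall v, linear (tens^~ v)) /\ (forall u, linear (tens u)).
Proof.
have tensZ a u v : a *: tens u v = tens (a *: u) v by exact: tensor_scaleE.
split=> [v|u] a x y; rewrite /= tensZ /tens; apply/esym.
- rewrite [LHS]tensor_addE; apply/tensor_eqP/tensor_rel_sym.
  exact: tensor_rel_Dl.
- rewrite [LHS]tensor_addE; apply/tensor_eqP/tensor_rel_sym.
  apply: tensor_rel_trans (tensor_rel_Dr _ _ _) _.
  apply: (@tensor_rel_cat [:: _] [:: _] [:: _] [:: _]).
    exact/tensor_rel_sym/tensor_rel_Z.
  exact: tensor_rel_refl.
Qed.

HB.instance Definition _ := isBilinear.Build R U V tensor *:%R *:%R tens
  (fun v => zmod_morphism_linear (proj1 tens_bilinear v))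
  (fun u => zmod_morphism_linear (proj2 tens_bilinear u))
  (fun v => scalable_linear (proj1 tens_bilinear v))
  (fun u => scalable_linear (proj2 tens_bilinear u)).

Lemma tensorP (x : tensor) : exists s, x = \sum_(p <- s) tens p.1 p.2.
Proof.
elim/quotW: x => s; exists s; elim: s => [|[u v] s IH]; first by rewrite big_nil.
by rewrite big_cons -IH -cat1s -tensor_addE.
Qed.

Section Lift.
Variables (W : lmodType R) (b : {bilinear U -> V -> W}).

Definition tensor_lift (x : tensor) : W := \sum_(p <- repr x) b p.1 p.2.

Lemma tensor_lift_pi s : tensor_lift << s >> = \sum_(p <- s) b p.1 p.2.
Proof.
rewrite /tensor_lift; move: (repr _) (tensor_repr s) => t.
elim=> {s t} //=.
- by move=> s t r _ -> _ ->.
- by move=> s s' t t' _ IHs _ IHt; rewrite !big_cat /= IHs IHt.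
- by move=> s t; rewrite !big_cat /= addrC.
- by move=> v; rewrite big_seq1 big_nil linear0l.
- by move=> u; rewrite big_seq1 big_nil linear0r.
- by move=> u u' v; rewrite big_seq1 big_cons big_seq1 linearDl.
- by move=> u v v'; rewrite big_seq1 big_cons big_seq1 linearDr.
- by move=> a u v; rewrite !big_seq1 linearZl_LR linearZr_LR.
Qed.

Lemma tensor_lift_linear : linear tensor_lift.
Proof.
move=> a; elim/quotW=> s; elim/quotW=> t.
rewrite [_ *: _]tensor_scaleE [_ + _ in LHS]tensor_addE !tensor_lift_pi.
rewrite big_cat big_map scaler_sumr /=; congr (_ + _).
by apply: eq_bigr => p _; rewrite linearZl_LR.
Qed.

HB.instance Definition _ := GRing.isLinear.Build R tensor W _ tensor_lift
  tensor_lift_linear.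

Lemma tensor_liftE u v : tensor_lift (tens u v) = b u v.
Proof. by rewrite tensor_lift_pi big_seq1. Qed.

End Lift.

Lemma tensor_lift_unique (W : lmodType R) (g h : {linear tensor -> W}) :
  (forall u v, g (tens u v) = h (tens u v)) -> g =1 h.
Proof.
move=> gh x; have [s ->] := tensorP x.
by rewrite !linear_sum; apply: eq_bigr => p _.
Qed.

End TensorProduct.

Arguments tens {R U V}.

Section TensorMap.
Variables (R : comNzRingType) (U V U' V' : lmodType R).
Variables (g : {linear U -> U'}) (h : {linear V -> V'}).

Definition tens_comp (u : U) (v : V) : tensor U' V' := tens (g u) (h v).

Lemma tens_comp_bilinear :
  (forall v, linear (tens_comp^~ v)) /\ (forall u, linear (tens_comp u)).
Proof.
split=> [v|u] a x y; rewrite /tens_comp linearP.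
- exact: linearPl.
- exact: linearPr.
Qed.

HB.instance Definition _ := isBilinear.Build R U V (tensor U' V') *:%R *:%R tens_comp
  (fun v => zmod_morphism_linear (proj1 tens_comp_bilinear v))
  (fun u => zmod_morphism_linear (proj2 tens_comp_bilinear u))
  (fun v => scalable_linear (proj1 tens_comp_bilinear v))
  (fun u => scalable_linear (proj2 tens_comp_bilinear u)).

Definition tensor_map : {linear tensor U V -> tensor U' V'} :=
  tensor_lift tens_comp.

Lemma tensor_mapE u v : tensor_map (tens u v) = tens (g u) (h v).
Proof. exact: tensor_liftE. Qed.

End TensorMap.

Section TensorAssoc.
Variables (R : comNzRingType) (U V W : lmodType R).

Section AssocL.
Variable u : U.

Definition tens_assoc1 (v : V) (w : W) : tensor (tensor U V) W :=
  tens (tens u v) w.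

Lemma tens_assoc1_bilinear :
  (forall v, linear (tens_assoc1^~ v)) /\ (forall u, linear (tens_assoc1 u)).
Proof.
split=> [w|v] a x y; rewrite /tens_assoc1; last exact: linearPr.
by rewrite linearPr linearPl.
Qed.

HB.instance Definition _ := isBilinear.Build R V W _ *:%R *:%R tens_assoc1
  (fun v => zmod_morphism_linear (proj1 tens_assoc1_bilinear v))
  (fun u => zmod_morphism_linear (proj2 tens_assoc1_bilinear u))
  (fun v => scalable_linear (proj1 tens_assoc1_bilinear v))
  (fun u => scalable_linear (proj2 tens_assoc1_bilinear u)).

Definition assocl_at (t : tensor V W) : tensor (tensor U V) W :=
  tensor_lift tens_assoc1 t.

Lemma assocl_at_linear : linear assocl_at.
Proof. exact: linearP. Qed.

HB.instance Definition _ := GRing.isLinear.Build R _ _ _ assocl_at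
  assocl_at_linear.

Lemma assocl_atE v w : assocl_at (tens v w) = tens (tens u v) w.
Proof. exact: tensor_liftE. Qed.

End AssocL.

Lemma assocl_at_bilinear :
  (forall v, linear (assocl_at^~ v)) /\ (forall u, linear (assocl_at u)).
Proof.
split=> [t|u] a x y /=; last exact: linearP.
move: t; apply: (@tensor_lift_unique _ _ _ _ (assocl_at (a *: x + y))
  (a \*: assocl_at x \+ assocl_at y)) => v w /=.
by rewrite !assocl_atE !linearPl.
Qed.

HB.instance Definition _ := isBilinear.Build R U (tensor V W) _ *:%R *:%R assocl_at
  (fun v => zmod_morphism_linear (proj1 assocl_at_bilinear v))
  (fun u => zmod_morphism_linear (proj2 assocl_at_bilinear u))
  (fun v => scalable_linear (proj1 assocl_at_bilinear v))
  (fun u => scalable_linear (proj2 assocl_at_bilinear u)).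

Definition tensor_assocl :
    {linear tensor U (tensor V W) -> tensor (tensor U V) W} :=
  tensor_lift assocl_at.

Lemma tensor_assoclE u v w :
  tensor_assocl (tens u (tens v w)) = tens (tens u v) w.
Proof. by apply: (etrans (tensor_liftE _ _ _)); exact: assocl_atE. Qed.

Section AssocR.
Variable w : W.

Definition tens_assoc2 (u : U) (v : V) : tensor U (tensor V W) :=
  tens u (tens v w).

Lemma tens_assoc2_bilinear :
  (forall v, linear (tens_assoc2^~ v)) /\ (forall u, linear (tens_assoc2 u)).
Proof.
split=> [v|u] a x y; rewrite /tens_assoc2; first exact: linearPl.
by rewrite linearPl linearPr.
Qed.

HB.instance Definition _ := isBilinear.Build R U V _ *:%R *:%R tens_assoc2
  (fun v => zmod_morphism_linear (proj1 tens_assoc2_bilinear v))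
  (fun u => zmod_morphism_linear (proj2 tens_assoc2_bilinear u))
  (fun v => scalable_linear (proj1 tens_assoc2_bilinear v))
  (fun u => scalable_linear (proj2 tens_assoc2_bilinear u)).

End AssocR.

Definition assocr_at (t : tensor U V) (w : W) : tensor U (tensor V W) :=
  tensor_lift (tens_assoc2 w) t.

Lemma assocr_atE u v w : assocr_at (tens u v) w = tens u (tens v w).
Proof. exact: tensor_liftE. Qed.

Lemma assocr_at_bilinear :
  (forall v, linear (assocr_at^~ v)) /\ (forall u, linear (assocr_at u)).
Proof.
split=> [w|t] a x y /=; first exact: linearP.
move: t; apply: (@tensor_lift_unique _ _ _ _
  (tensor_lift (tens_assoc2 (a *: x + y)))
  (a \*: tensor_lift (tens_assoc2 x) \+ tensor_lift (tens_assoc2 y))) => u v.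
rewrite /= !tensor_liftE.
exact: etrans (congr1 (tens u) (linearPr tens v a x y)) (linearPr tens u a _ _).
Qed.

HB.instance Definition _ := isBilinear.Build R (tensor U V) W _ *:%R *:%R assocr_at
  (fun v => zmod_morphism_linear (proj1 assocr_at_bilinear v))
  (fun u => zmod_morphism_linear (proj2 assocr_at_bilinear u))
  (fun v => scalable_linear (proj1 assocr_at_bilinear v))
  (fun u => scalable_linear (proj2 assocr_at_bilinear u)).

Definition tensor_assocr :
    {linear tensor (tensor U V) W -> tensor U (tensor V W)} :=
  tensor_lift assocr_at.

Lemma tensor_assocrE u v w :
  tensor_assocr (tens (tens u v) w) = tens u (tens v w).
Proof. by apply: (etrans (tensor_liftE _ _ _)); exact: assocr_atE. Qed.

End TensorAssoc.

Section SLieAlgebra.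
Variables (K : fieldType) (L : lmodType K).
Variables (f : {linear tensor L L -> L}).
Variables (S : {linear tensor L L -> tensor L L}).

(* The triple tensor product is (L (x) L) (x) L; maps acting on the last two
   factors are transported along the associativity isomorphism. *)
Definition tensor3 : lmodType K := tensor (tensor L L) L.

Definition S12 : tensor3 -> tensor3 := tensor_map S idfun.

Definition S23 : tensor3 -> tensor3 :=
  @tensor_assocl K L L L \o tensor_map idfun S \o @tensor_assocr K L L L.

Definition f12 : tensor3 -> tensor L L := tensor_map f idfun.

Definition f23 : tensor3 -> tensor L L :=
  tensor_map idfun f \o @tensor_assocr K L L L.

Record is_S_Lie_algebra : Prop := IsSLieAlgebra {
  S_Lie_involutive : S \o S =1 idfun;
  S_Lie_braid : S12 \o S23 \o S12 =1 S23 \o S12 \o S23;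
  S_Lie_f12 : S \o f12 =1 f23 \o S12 \o S23;
  S_Lie_f23 : S \o f23 =1 f12 \o S23 \o S12;
  S_Lie_antisym : f \o S =1 \- f;
  S_Lie_jacobi : f \o f12 =1 (f \o f23) \- (f \o f23 \o S12)
}.

End SLieAlgebra.

Record is_commuting_factor (K : fieldType) (Gamma : zmodType)
    (eps : Gamma -> Gamma -> K) : Prop := IsCommutingFactor {
  commuting_factor_neq0 : forall a b, eps a b != 0;
  commuting_factor_sym : forall a b, eps a b * eps b a = 1;
  commuting_factorDr : forall a b c, eps a (b + c) = eps a b * eps a c;
  commuting_factorDl : forall a b c, eps (a + b) c = eps a c * eps b c
}.

(* The internal direct sum g = (+)_(c : Gamma) gr c. *)
Record is_grading (K : fieldType) (Gamma : zmodType) (g : lmodType K)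
    (gr : Gamma -> {pred g}) : Prop := IsGrading {
  grading_submod : forall c, submod_closed (gr c);
  grading_span : forall x : g, exists (s : seq Gamma) (xs : Gamma -> g),
    [/\ uniq s, forall c, xs c \in gr c & x = \sum_(c <- s) xs c];
  grading_direct : forall (s : seq Gamma) (xs : Gamma -> g),
    uniq s -> (forall c, xs c \in gr c) -> \sum_(c <- s) xs c = 0 ->
    forall c, c \in s -> xs c = 0
}.

Record is_color_Lie_algebra (K : fieldType) (Gamma : zmodType)
    (eps : Gamma -> Gamma -> K) (g : lmodType K) (gr : Gamma -> {pred g})
    (br : {bilinear g -> g -> g}) : Prop := IsColorLieAlgebra {
  color_grading : is_grading gr;
  color_graded : forall a b X Y,
    X \in gr a -> Y \in gr b -> br X Y \in gr (a + b);
  color_antisym : forall a b X Y,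
    X \in gr a -> Y \in gr b -> br X Y = - (eps a b *: br Y X);
  color_jacobi : forall a b c X Y Z,
    X \in gr a -> Y \in gr b -> Z \in gr c ->
    eps c a *: br X (br Y Z) + eps a b *: br Y (br Z X)
      + eps b c *: br Z (br X Y) = 0
}.

Definition is_color_flip (K : fieldType) (Gamma : zmodType)
    (eps : Gamma -> Gamma -> K) (g : lmodType K) (gr : Gamma -> {pred g})
    (S : {linear tensor g g -> tensor g g}) : Prop :=
  forall a b X Y, X \in gr a -> Y \in gr b ->
    S (tens X Y) = eps a b *: tens Y X.

Definition is_color_bracket (K : fieldType) (Gamma : zmodType)
    (g : lmodType K) (gr : Gamma -> {pred g}) (br : {bilinear g -> g -> g})
    (f : {linear tensor g g -> g}) : Prop :=
  forall a b X Y, X \in gr a -> Y \in gr b -> f (tens X Y) = br X Y.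

(* Main.v *)
Require Import Defs.
From HB Require Import structures.
From mathcomp Require Import all_boot all_algebra.
From mathcomp Require Import boolp sesquilinear.

Set Implicit Arguments.
Unset Strict Implicit.
Unset Printing Implicit Defensive.

Import GRing.Theory.
Local Open Scope ring_scope.

(** Both halves of the theorem reduce to homogeneous elements.

    For the existence of [f] and [S], directness of the grading gives linear
    homogeneous components, so a family of linear maps [phi c], one for each
    degree, glues to a single linear map that agrees with [phi c] on degree
    [c] ([graded_ext]).  Gluing twice yields the color flip: the maps
    [twist a], which multiply degree [b] by [eps a b], and then, for a fixed
    [y], the maps [x |-> twist a y (x) x].  The bracket [f] is the map that
    [br] induces on the tensor product.

    For the axioms, linear maps on the double or triple tensor product are
    determined by their values on tensors of homogeneous elements
    ([tensor_hom_ext], [tensor3_hom_ext]).  There [S12], [S23], [f12] and [f23]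
    are given by explicit formulas.  Involutivity of [S] is the symmetry of
    [eps]; in the braid relation both sides reverse the three factors with the
    same scalar; the two compatibilities of [S] with [f] are the biadditivity
    of [eps], as the bracket adds degrees; [f \o S = - f] is color
    antisymmetry; and the last axiom is the color Jacobi identity multiplied
    by [eps a c] ([color_leibniz]). *)

(** The bilinear structure on [tens] does not make its partial applications
    canonically linear. *)
HB.instance Definition _ (R : comNzRingType) (U V : lmodType R) (u : U) :=
  GRing.isLinear.Build R V (tensor U V) _ (tens u) (linearPr tens u).

(** * Homogeneous components *)

Section Grading.
Variables (K : fieldType) (Gamma : zmodType) (g : lmodType K).
Variables (gr : Gamma -> {pred g}) (gradP : is_grading gr).

Lemma grading0 c : 0 \in gr c.
Proof. by have [] := grading_submod gradP c. Qed.

Lemma gradingP c a x y : x \in gr c -> y \in gr c -> a *: x + y \in gr c.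
Proof. by have [_] := grading_submod gradP c; apply. Qed.

Lemma homogeneous_decomposition x :
  exists p : seq Gamma * (Gamma -> g),
    [/\ uniq p.1, forall c, p.2 c \in gr c & x = \sum_(c <- p.1) p.2 c].
Proof. by have [s [xs H]] := grading_span gradP x; exists (s, xs). Qed.

(** A finite set of degrees outside which the components of [x] vanish; it
    comes from a chosen decomposition and may contain degrees whose component
    is zero. *)
Definition degrees x : seq Gamma :=
  (projT1 (cid (homogeneous_decomposition x))).1.

(** The component of degree [c] of [x]. *)
Definition component c x : g :=
  if c \in degrees x then (projT1 (cid (homogeneous_decomposition x))).2 c
  else 0.

Lemma degrees_uniq x : uniq (degrees x).
Proof. by rewrite /degrees; case: cid => p []. Qed.

Lemma component_in c x : component c x \in gr c.
Proof.
rewrite /component; case: ifP => _; last exact: grading0.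
by case: cid => p [].
Qed.

Lemma component_notin c x : c \notin degrees x -> component c x = 0.
Proof. by rewrite /component => /negbTE ->. Qed.

Lemma big_component_widen (W : zmodType) (F : Gamma -> g -> W) s x :
  (forall c, F c 0 = 0) -> uniq s -> {subset degrees x <= s} ->
  \sum_(c <- s) F c (component c x) = \sum_(c <- degrees x) F c (component c x).
Proof.
move=> F0 us sub; rewrite (bigID (mem (degrees x))) /= [X in _ + X]big1 ?addr0.
  rewrite -big_filter; apply: perm_big; apply: uniq_perm.
  - exact: filter_uniq.
  - exact: degrees_uniq.
  - by move=> c; rewrite mem_filter; apply: andb_idr => /sub.
by move=> c cx; rewrite component_notin.
Qed.

Lemma sum_component s x : uniq s -> {subset degrees x <= s} ->
  x = \sum_(c <- s) component c x.
Proof.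
move=> us sub; rewrite (@big_component_widen _ (fun _ => id)) //.
rewrite {1}(_ : x = \sum_(c <- degrees x)
  (projT1 (cid (homogeneous_decomposition x))).2 c).
  by rewrite !big_seq; apply: eq_bigr => c cx; rewrite /component cx.
by rewrite /degrees; case: cid => p [].
Qed.

(** By directness, a decomposition into homogeneous elements is unique. *)
Lemma component_unique s (xs : Gamma -> g) x :
  uniq s -> {subset degrees x <= s} -> (forall c, xs c \in gr c) ->
  x = \sum_(c <- s) xs c -> forall c, c \in s -> component c x = xs c.
Proof.
move=> us sub xsP xE c cs; apply/eqP; rewrite -subr_eq0; apply/eqP.
apply: (@grading_direct _ _ _ _ gradP s (fun c => component c x - xs c)) => //.
  by move=> d; rewrite addrC -scaleN1r gradingP ?component_in.
by rewrite sumrB -xE -sum_component ?subrr.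
Qed.

Lemma component_linear c : linear (component c).
Proof.
move=> a x y; set z := a *: x + y.
pose s := undup (c :: degrees z ++ degrees x ++ degrees y).
have us : uniq s by exact: undup_uniq.
have subz : {subset degrees z <= s}.
  by move=> d dz; rewrite mem_undup inE mem_cat dz orbT.
have subx : {subset degrees x <= s}.
  by move=> d dx; rewrite mem_undup inE !mem_cat dx !orbT.
have suby : {subset degrees y <= s}.
  by move=> d dy; rewrite mem_undup inE !mem_cat dy !orbT.
apply: (@component_unique s
  (fun c => a *: component c x + component c y)) => //.
- by move=> d; apply: gradingP; exact: component_in.
- by rewrite big_split -scaler_sumr /= -!sum_component.
- by rewrite mem_undup mem_head.
Qed.

HB.instance Definition _ c :=
  GRing.isLinear.Build K g g _ (component c) (component_linear c).

Lemma component_hom c d x : x \in gr c ->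
  component d x = if d == c then x else 0.
Proof.
move=> xc; pose s := undup (d :: c :: degrees x).
apply: (@component_unique s (fun d => if d == c then x else 0)).
- exact: undup_uniq.
- by move=> e ex; rewrite mem_undup !inE ex !orbT.
- by move=> e; case: eqP => [->|_] //; exact: grading0.
- have cs : c \in s by rewrite mem_undup !inE eqxx orbT.
  rewrite (bigD1_seq c) ?undup_uniq //= eqxx big1 ?addr0 //.
  by move=> e /negbTE ->.
- by rewrite mem_undup mem_head.
Qed.

Lemma hom_ext (W : lmodType K) (h k : {linear g -> W}) :
  (forall c x, x \in gr c -> h x = k x) -> h =1 k.
Proof.
move=> hk x; rewrite (sum_component (degrees_uniq x) (fun _ => id)).
by rewrite !linear_sum; apply: eq_bigr => c _; apply: hk (component_in c x).
Qed.

(** The linear map that is [phi c] on degree [c]. *)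
Definition graded_ext (W : lmodType K) (phi : Gamma -> {linear g -> W}) x : W :=
  \sum_(c <- degrees x) phi c (component c x).

Section GradedExt.
Variables (W : lmodType K) (phi : Gamma -> {linear g -> W}).

Lemma graded_ext_widen s x : uniq s -> {subset degrees x <= s} ->
  graded_ext phi x = \sum_(c <- s) phi c (component c x).
Proof.
move=> us sub; rewrite (@big_component_widen _ (fun c => phi c)) // => c.
exact: linear0.
Qed.

Lemma graded_ext_linear : linear (graded_ext phi).
Proof.
move=> a x y; set z := a *: x + y.
pose s := undup (degrees z ++ degrees x ++ degrees y).
have us : uniq s by exact: undup_uniq.
have subz : {subset degrees z <= s}.
  by move=> d dz; rewrite mem_undup mem_cat dz.
have subx : {subset degrees x <= s}.
  by move=> d dx; rewrite mem_undup !mem_cat dx !orbT.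
have suby : {subset degrees y <= s}.
  by move=> d dy; rewrite mem_undup !mem_cat dy !orbT.
rewrite !(@graded_ext_widen s) // scaler_sumr -big_split /=.
by apply: eq_bigr => c _; rewrite !linearP.
Qed.

HB.instance Definition _ :=
  GRing.isLinear.Build K g W _ (graded_ext phi) graded_ext_linear.

Lemma graded_extE c x : x \in gr c -> graded_ext phi x = phi c x.
Proof.
move=> xc; rewrite (@graded_ext_widen (undup (c :: degrees x))) ?undup_uniq //.
  rewrite (bigD1_seq c) ?undup_uniq ?mem_undup ?mem_head //=.
  rewrite (component_hom _ xc) eqxx big1 ?addr0 // => d /negbTE dc.
  by rewrite (component_hom _ xc) dc linear0.
by move=> d dx; rewrite mem_undup inE dx orbT.
Qed.

End GradedExt.

(** * Linear maps determined on homogeneous tensors *)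

Lemma tensor_hom_ext (W : lmodType K) (h k : {linear tensor g g -> W}) :
  (forall a b x y, x \in gr a -> y \in gr b -> h (tens x y) = k (tens x y)) ->
  h =1 k.
Proof.
move=> hk; apply: tensor_lift_unique => x y.
move: x; apply: (@hom_ext _ (h \o applyr tens y) (k \o applyr tens y)).
move=> a x xa /=.
move: y; apply: (@hom_ext _ (h \o tens x) (k \o tens x)) => b y yb /=.
exact: hk xa yb.
Qed.

Lemma tensor3_hom_ext (W : lmodType K) (h k : {linear tensor3 g -> W}) :
  (forall a b c x y z, x \in gr a -> y \in gr b -> z \in gr c ->
    h (tens (tens x y) z) = k (tens (tens x y) z)) ->
  h =1 k.
Proof.
move=> hk; apply: tensor_lift_unique => t z.
move: t; apply: (@tensor_hom_ext _ (h \o applyr tens z) (k \o applyr tens z)).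
move=> a b x y xa yb /=.
move: z; apply: (@hom_ext _ (h \o tens (tens x y)) (k \o tens (tens x y))).
by move=> c z zc /=; exact: hk xa yb zc.
Qed.

(** * The color flip *)

Section Flip.
Variable eps : Gamma -> Gamma -> K.

(** Multiplication by [eps a b] on degree [b]. *)
Definition twist a : g -> g := graded_ext (fun b => eps a b \*: idfun).

HB.instance Definition _ a := GRing.Linear.on (twist a).

Lemma twistE a b y : y \in gr b -> twist a y = eps a b *: y.
Proof. by move=> yb; rewrite /twist (graded_extE _ yb). Qed.

(** The bilinear map [(x, y) |-> eps a b *: tens y x], for [x] of degree [a]
    and [y] of degree [b]. *)
Definition color_flip x y : tensor g g :=
  graded_ext (fun a => tens (twist a y)) x.

Lemma color_flip_hom a b x y : x \in gr a -> y \in gr b ->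
  color_flip x y = eps a b *: tens y x.
Proof.
by move=> xa yb; rewrite /color_flip (graded_extE _ xa) /= (twistE _ yb)
  linearZl_LR.
Qed.

Lemma color_flip_bilinear :
  (forall y, linear (color_flip^~ y)) /\ (forall x, linear (color_flip x)).
Proof.
split=> [y|x] a u v; first exact: linearP.
rewrite /color_flip /graded_ext scaler_sumr -big_split /=.
by apply: eq_bigr => c _; rewrite linearP linearPl.
Qed.

HB.instance Definition _ := isBilinear.Build K g g (tensor g g) *:%R *:%R
  color_flip
  (fun v => zmod_morphism_linear (proj1 color_flip_bilinear v))
  (fun u => zmod_morphism_linear (proj2 color_flip_bilinear u))
  (fun v => scalable_linear (proj1 color_flip_bilinear v))
  (fun u => scalable_linear (proj2 color_flip_bilinear u)).

Lemma color_flip_exists :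
  exists S : {linear tensor g g -> tensor g g}, is_color_flip eps gr S.
Proof.
exists (tensor_lift color_flip) => a b x y xa yb.
exact: etrans (tensor_liftE _ _ _) (color_flip_hom xa yb).
Qed.

End Flip.

End Grading.

(** * The maps on the triple tensor product *)

Section TripleMaps.
Variables (K : fieldType) (L : lmodType K).
Variables (f : {linear tensor L L -> L}).
Variables (S : {linear tensor L L -> tensor L L}).

HB.instance Definition _ := GRing.Linear.copy (S12 S) (tensor_map S idfun).
HB.instance Definition _ := GRing.Linear.copy (S23 S)
  (@tensor_assocl K L L L \o tensor_map idfun S \o @tensor_assocr K L L L).
HB.instance Definition _ := GRing.Linear.copy (f12 f) (tensor_map f idfun).
HB.instance Definition _ := GRing.Linear.copy (f23 f)
  (tensor_map idfun f \o @tensor_assocr K L L L).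

Lemma f12E x y z : f12 f (tens (tens x y) z) = tens (f (tens x y)) z.
Proof. exact: tensor_mapE. Qed.

Lemma f23E x y z : f23 f (tens (tens x y) z) = tens x (f (tens y z)).
Proof. by rewrite /f23 /= tensor_assocrE tensor_mapE. Qed.

Variables (Gamma : zmodType) (eps : Gamma -> Gamma -> K).
Variables (gr : Gamma -> {pred L}) (SP : is_color_flip eps gr S).

Lemma S12E a b x y z : x \in gr a -> y \in gr b ->
  S12 S (tens (tens x y) z) = eps a b *: tens (tens y x) z.
Proof.
by move=> xa yb; rewrite /S12 tensor_mapE (SP xa yb) linearZl_LR.
Qed.

Lemma S23E b c x y z : y \in gr b -> z \in gr c ->
  S23 S (tens (tens x y) z) = eps b c *: tens (tens x z) y.
Proof.
move=> yb zc; rewrite /S23 /= tensor_assocrE tensor_mapE (SP yb zc).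
by rewrite linearZr_LR linearZ /= tensor_assoclE.
Qed.

End TripleMaps.

(** * The axioms of an S-Lie algebra *)

Section ColorLie.
Variables (K : fieldType) (Gamma : zmodType) (eps : Gamma -> Gamma -> K).
Variables (eps_cf : is_commuting_factor eps).
Variables (g : lmodType K) (gr : Gamma -> {pred g}).
Variables (br : {bilinear g -> g -> g}).
Variable (g_color : is_color_Lie_algebra eps gr br).

(** The Leibniz form of the color Jacobi identity: [br x] is a color
    derivation. *)
Lemma color_leibniz a b c x y z : x \in gr a -> y \in gr b -> z \in gr c ->
  br (br x y) z = br x (br y z) - eps a b *: br y (br x z).
Proof.
move=> xa yb zc; have := color_jacobi g_color xa yb zc.
rewrite (color_antisym g_color zc xa) linearNr linearZr_LR /= scalerN scalerA.
move=> /(congr1 (fun u => eps a c *: u)); rewrite scaler0 !scalerDr scalerN.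
have e1 : eps a c * (eps a b * eps c a) = eps a b.
  by rewrite mulrCA (commuting_factor_sym eps_cf) mulr1.
rewrite !scalerA (commuting_factor_sym eps_cf) scale1r e1.
rewrite -(commuting_factorDl eps_cf) => /eqP; rewrite addr_eq0 => /eqP ->.
by rewrite (color_antisym g_color (color_graded g_color xa yb) zc).
Qed.

Lemma color_S_Lie (f : {linear tensor g g -> g})
    (S : {linear tensor g g -> tensor g g}) :
  is_color_bracket gr br f -> is_color_flip eps gr S -> is_S_Lie_algebra f S.
Proof.
move=> fP SP; have gradP := color_grading g_color.
have brP := color_graded g_color.
split.
- apply: (tensor_hom_ext gradP (h := S \o S)) => a b x y xa yb /=.
  rewrite (SP _ _ _ _ xa yb) linearZ /= (SP _ _ _ _ yb xa) scalerA.
  by rewrite (commuting_factor_sym eps_cf) scale1r.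
- apply: (tensor3_hom_ext gradP (h := S12 S \o S23 S \o S12 S)
    (k := S23 S \o S12 S \o S23 S)) => a b c x y z xa yb zc /=.
  rewrite (S12E SP _ xa yb) (S23E SP _ yb zc) !linearZ /=.
  rewrite (S23E SP _ xa zc) (S12E SP _ xa zc) !linearZ /=.
  rewrite (S12E SP _ yb zc) (S23E SP _ xa yb) !scalerA.
  by rewrite mulrC mulrA mulrAC (mulrC (eps b c)) mulrAC.
- apply: (tensor3_hom_ext gradP (h := S \o f12 f)
    (k := f23 f \o S12 S \o S23 S)) => a b c x y z xa yb zc /=.
  rewrite f12E (fP _ _ _ _ xa yb) (SP _ _ _ _ (brP _ _ _ _ xa yb) zc).
  rewrite (S23E SP _ yb zc) linearZ /= (S12E SP _ xa zc) !linearZ /= f23E.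
  by rewrite (fP _ _ _ _ xa yb) scalerA (commuting_factorDl eps_cf) mulrC.
- apply: (tensor3_hom_ext gradP (h := S \o f23 f)
    (k := f12 f \o S23 S \o S12 S)) => a b c x y z xa yb zc /=.
  rewrite f23E (fP _ _ _ _ yb zc) (SP _ _ _ _ xa (brP _ _ _ _ yb zc)).
  rewrite (S12E SP _ xa yb) linearZ /= (S23E SP _ xa zc) !linearZ /= f12E.
  by rewrite (fP _ _ _ _ yb zc) scalerA (commuting_factorDr eps_cf).
- apply: (tensor_hom_ext gradP (h := f \o S) (k := \- f)) => a b x y xa yb /=.
  rewrite (SP _ _ _ _ xa yb) linearZ /= (fP _ _ _ _ yb xa) (fP _ _ _ _ xa yb).
  by rewrite (color_antisym g_color xa yb) opprK.
- apply: (tensor3_hom_ext gradP (h := f \o f12 f)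
    (k := (f \o f23 f) \- (f \o f23 f \o S12 S))) => a b c x y z xa yb zc /=.
  rewrite (S12E SP _ xa yb) f12E f23E !linearZ /= f23E.
  rewrite (fP _ _ _ _ xa yb) (fP _ _ _ _ yb zc) (fP _ _ _ _ xa zc).
  rewrite (fP _ _ _ _ (brP _ _ _ _ xa yb) zc).
  rewrite (fP _ _ _ _ xa (brP _ _ _ _ yb zc)).
  rewrite (fP _ _ _ _ yb (brP _ _ _ _ xa zc)).
  rewrite scalerN; exact: color_leibniz xa yb zc.
Qed.

End ColorLie.

Theorem proposition3p3 (K : fieldType) (charK : [pchar K] =i pred0)
    (Gamma : zmodType) (eps : Gamma -> Gamma -> K)
    (eps_cf : is_commuting_factor eps)
    (g : lmodType K) (gr : Gamma -> {pred g}) (br : {bilinear g -> g -> g})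
    (g_color : is_color_Lie_algebra eps gr br) :
  (exists (f : {linear tensor g g -> g})
          (S : {linear tensor g g -> tensor g g}),
     is_color_bracket gr br f /\ is_color_flip eps gr S) /\
  (forall (f : {linear tensor g g -> g})
          (S : {linear tensor g g -> tensor g g}),
     is_color_bracket gr br f -> is_color_flip eps gr S ->
     is_S_Lie_algebra f S).
Proof.
split; last by move=> f S; exact: color_S_Lie.
have [S SP] := color_flip_exists (color_grading g_color) eps.
by exists (tensor_lift br), S; split=> // a b x y _ _; exact: tensor_liftE.
Qed.
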